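(* Let $n$ be a positive integer, let $x,y\in\mathbb{C}^n$ and $v,w\in\mathbb{H}^n$. Then: (i) $\langle x|y\rangle_{\mathbb C}=\langle r_{\mathbb C}(x)|r_{\mathbb C}(y)\rangle_{\mathbb R}-\langle r_{\mathbb C}(x)|r_{\mathbb C}\circ\alpha_i(y)\rangle_{\mathbb R}\,i$. (ii) $\langle v|w\rangle_{\mathbb H}=\langle c_{\mathbb H}(v)|c_{\mathbb H}(w)\rangle_{\mathbb C}-\langle c_{\mathbb H}(v)|c_{\mathbb H}\circ\alpha_j(w)\rangle_{\mathbb C}\,j$. (iii) $\langle v|w\rangle_{\mathbb H}=\langle r_{\mathbb H}(v)|r_{\mathbb H}(w)\rangle_{\mathbb R}-\langle r_{\mathbb H}(v)|r_{\mathbb H}\circ\alpha_i(w)\rangle_{\mathbb R}\,i-\langle r_{\mathbb H}(v)|r_{\mathbb H}\circ\alpha_j(w)\rangle_{\mathbb R}\,j-\langle r_{\mathbb H}(v)|r_{\mathbb H}\circ\alpha_k(w)\rangle_{\mathbb R}\,k$.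
   Context: $\mathbb{F}$ denotes one of $\mathbb{R}$, $\mathbb{C}=\{a+bi\}$, $\mathbb{H}=\{a+bi+cj+dk\}$ ($a,b,c,d\in\mathbb{R}$), with usual conjugation and $\mathbb{R}\subset\mathbb{C}\subset\mathbb{H}$. $\mathbb{F}^n$ is a right inner product space over $\mathbb{F}$ with $\langle(x_1,\ldots,x_n)|(y_1,\ldots,y_n)\rangle_{\mathbb F}=\sum_{m=1}^n\bar{x}_m y_m$. The realification $r_{\mathbb C}:\mathbb{C}^n\to\mathbb{R}^{2n}$ is $r_{\mathbb C}(a_1+b_1i,\ldots,a_n+b_ni)=(a_1,b_1,\ldots,a_n,b_n)$. The complexification $c_{\mathbb H}:\mathbb{H}^n\to\mathbb{C}^{2n}$ is $c_{\mathbb H}(a_1+b_1i+c_1j+d_1k,\ldots,a_n+b_ni+c_nj+d_nk)=(a_1+b_1i,\,d_1+c_1i,\ldots,a_n+b_ni,\,d_n+c_ni)$. The realification $r_{\mathbb H}:\mathbb{H}^n\to\mathbb{R}^{4n}$ is $r_{\mathbb H}=r_{\mathbb C}\circ c_{\mathbb H}$ (with $r_{\mathbb C}$ here on $\mathbb{C}^{2n}$). For $t\in\mathbb{F}$, $\alpha_t:\mathbb{F}^n\to\mathbb{F}^n$ is right multiplication, $\alpha_t(x)=x\cdot t$. *)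

(* Defs.v *)
From HB Require Import structures.
From mathcomp Require Import all_boot all_order all_algebra.
From mathcomp Require Import complex.
From mathcomp Require Import reals.
From mathcomp Require Import ring.

Set Implicit Arguments.
Unset Strict Implicit.
Unset Printing Implicit Defensive.

Import GRing.Theory.
Local Open Scope ring_scope.

(* Quat a b c d stands for a + b i + c j + d k. *)
Record quaternion (R : Type) : Type :=
  Quat { quatr : R; quati : R; quatj : R; quatk : R }.

Section QuaternionChoice.
Variable R : Type.

Definition tuple_of_quat (q : quaternion R) : R * R * R * R :=
  let: Quat a b c d := q in (a, b, c, d).
Definition quat_of_tuple (t : R * R * R * R) : quaternion R :=
  let: (a, b, c, d) := t in Quat a b c d.
Lemma tuple_of_quatK : cancel tuple_of_quat quat_of_tuple.
Proof. by case. Qed.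
End QuaternionChoice.

HB.instance Definition _ (R : eqType) :=
  Equality.copy (quaternion R) (can_type (@tuple_of_quatK R)).
HB.instance Definition _ (R : choiceType) :=
  Choice.copy (quaternion R) (can_type (@tuple_of_quatK R)).

Section QuaternionRing.
Variable R : comNzRingType.
Implicit Types p q r : quaternion R.

Definition addq p q : quaternion R :=
  let: Quat a b c d := p in let: Quat a' b' c' d' := q in
  Quat (a + a') (b + b') (c + c') (d + d').
Definition oppq p : quaternion R :=
  let: Quat a b c d := p in Quat (- a) (- b) (- c) (- d).
Definition mulq p q : quaternion R :=
  let: Quat a b c d := p in let: Quat a' b' c' d' := q in
  Quat (a * a' - b * b' - c * c' - d * d')
       (a * b' + b * a' + c * d' - d * c')
       (a * c' - b * d' + c * a' + d * b')
       (a * d' + b * c' - c * b' + d * a').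

Lemma addqA : associative addq.
Proof. by case=> ? ? ? ? [? ? ? ?] [? ? ? ?] /=; rewrite !addrA. Qed.
Lemma addqC : commutative addq.
Proof. by case=> ? ? ? ? [? ? ? ?] /=; congr Quat; apply: addrC. Qed.
Lemma add0q : left_id (Quat 0 0 0 0) addq.
Proof. by case=> ? ? ? ? /=; rewrite !add0r. Qed.
Lemma addNq : left_inverse (Quat 0 0 0 0) oppq addq.
Proof. by case=> ? ? ? ? /=; rewrite !addNr. Qed.

HB.instance Definition _ :=
  GRing.isZmodule.Build (quaternion R) addqA addqC add0q addNq.

Lemma mulqA : associative mulq.
Proof. by case=> ? ? ? ? [? ? ? ?] [? ? ? ?] /=; congr Quat; ring. Qed.
Lemma mul1q : left_id (Quat 1 0 0 0) mulq.
Proof. by case=> ? ? ? ? /=; congr Quat; ring. Qed.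
Lemma mulq1 : right_id (Quat 1 0 0 0) mulq.
Proof. by case=> ? ? ? ? /=; congr Quat; ring. Qed.
Lemma mulqDl : left_distributive mulq addq.
Proof. by case=> ? ? ? ? [? ? ? ?] [? ? ? ?] /=; congr Quat; ring. Qed.
Lemma mulqDr : right_distributive mulq addq.
Proof. by case=> ? ? ? ? [? ? ? ?] [? ? ? ?] /=; congr Quat; ring. Qed.
Lemma oneq_neq0 : Quat 1 0 0 0 != 0 :> quaternion R.
Proof. by apply/eqP => -[/eqP]; rewrite oner_eq0. Qed.

HB.instance Definition _ := GRing.Zmodule_isNzRing.Build (quaternion R)
  mulqA mul1q mulq1 mulqDl mulqDr oneq_neq0.

Definition conjq q : quaternion R :=
  let: Quat a b c d := q in Quat a (- b) (- c) (- d).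

Definition qi : quaternion R := Quat 0 1 0 0.
Definition qj : quaternion R := Quat 0 0 1 0.
Definition qk : quaternion R := Quat 0 0 0 1.

(* The inclusion of C into H; a real a is seen in H as a%:C%:H. *)
Definition quat_complex (z : R[i]) : quaternion R :=
  Quat (complex.Re z) (complex.Im z) 0 0.
End QuaternionRing.

Arguments qi {R}.
Arguments qj {R}.
Arguments qk {R}.

Notation "z %:H" := (quat_complex z)
  (at level 2, left associativity, format "z %:H") : ring_scope.

Definition inner (F : pzRingType) (conj : F -> F) (n : nat)
    (x y : 'rV[F]_n) : F :=
  \sum_(m < n) conj (x 0 m) * y 0 m.

Definition innerR (R : realType) (n : nat) : 'rV[R]_n -> 'rV[R]_n -> R :=
  @inner R id n.
Definition innerC (R : realType) (n : nat) :
    'rV[R[i]]_n -> 'rV[R[i]]_n -> R[i] :=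
  @inner R[i] conjc n.
Definition innerH (R : realType) (n : nat) :
    'rV[quaternion R]_n -> 'rV[quaternion R]_n -> quaternion R :=
  @inner (quaternion R) (@conjq R) n.

(* The right scalar action; *: on row vectors would be the left one. *)
Definition alpha (F : pzRingType) (n : nat) (t : F) (x : 'rV[F]_n) :
    'rV[F]_n :=
  \row_m (x 0 m * t).

Lemma half_ord_subproof (n : nat) (m : 'I_(2 * n)) : (m./2 < n)%N.
Proof. by rewrite ltn_half_double -mul2n. Qed.

Definition half_ord (n : nat) (m : 'I_(2 * n)) : 'I_n :=
  Ordinal (half_ord_subproof m).

(* (x_1, ..., x_n) |-> (f x_1, g x_1, ..., f x_n, g x_n) *)
Definition interleave (A B : Type) (f g : A -> B) (n : nat) (x : 'rV[A]_n) :
    'rV[B]_(2 * n) :=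
  \row_(m < 2 * n)
    if odd m then g (x 0 (half_ord m)) else f (x 0 (half_ord m)).

Definition realC (R : realType) (n : nat) : 'rV[R[i]]_n -> 'rV[R]_(2 * n) :=
  @interleave R[i] R (@complex.Re R) (@complex.Im R) n.

Definition complexH (R : realType) (n : nat) :
    'rV[quaternion R]_n -> 'rV[R[i]]_(2 * n) :=
  @interleave (quaternion R) R[i]
    (fun q => Complex (quatr q) (quati q))
    (fun q => Complex (quatk q) (quatj q)) n.

Definition realH (R : realType) (n : nat) :
    'rV[quaternion R]_n -> 'rV[R]_(2 * (2 * n)) :=
  @realC R (2 * n) \o @complexH R n.

(* Main.v *)
(* Each map preserves a component of the inner product: <r_C x|r_C y> = Re <x|y>,
   and <c_H v|c_H w> is the projection of <v|w> on C along Cj.  Since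
   <v|alpha_t w> = <v|w> t, the other components of <v|w> are read off, up to sign,
   from the products of <v|w> with i, j and k. *)

Require Import Defs.
From mathcomp Require Import all_boot all_order all_algebra.
From mathcomp Require Import complex reals ring.

Import GRing.Theory.
Local Open Scope ring_scope.
Local Open Scope complex_scope.

Lemma sum_ord_double (V : nmodType) (n : nat) (F : nat -> V) :
  \sum_(m < 2 * n) F m = \sum_(m < n) (F m.*2 + F m.*2.+1).
Proof.
rewrite mul2n; elim: n => [|n IHn]; first by rewrite !big_ord0.
by rewrite doubleS !big_ord_recr /= IHn addrA.
Qed.

Lemma inner_interleave (A : Type) (F : pzRingType) (conj : F -> F)
    (f g : A -> F) (n : nat) (x y : 'rV[A]_n) :
  inner conj (interleave f g x) (interleave f g y) =
  \sum_(m < n) (conj (f (x 0 m)) * f (y 0 m) + conj (g (x 0 m)) * g (y 0 m)).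
Proof.
case: n x y => [|n] x y; first by rewrite /inner !big_ord0.
(* [h] extends [half_ord] to all of [nat], so that the summand [G] fits [sum_ord_double]; [inord]
   wants a nonempty ordinal type, whence the separate case n = 0. *)
pose h (k : nat) : 'I_n.+1 := inord k./2.
have hE (m : 'I_(2 * n.+1)) : half_ord m = h m.
  by apply/val_inj; rewrite /= inordK // ltn_half_double -mul2n.
pose G (k : nat) : F :=
  if odd k then conj (g (x 0 (h k))) * g (y 0 (h k))
  else conj (f (x 0 (h k))) * f (y 0 (h k)).
transitivity (\sum_(m < 2 * n.+1) G m).
  by apply: eq_bigr => m _; rewrite !mxE hE /G; case: ifP.
rewrite sum_ord_double; apply: eq_bigr => m _.
by rewrite /G /h /= odd_double /= uphalf_double doubleK inord_val.
Qed.

(** The scalar is the rightmost factor of every summand, so it factors out by distributivity, over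
    the quaternions as well. *)
Lemma inner_alphar (F : pzRingType) (conj : F -> F) (n : nat) (t : F)
    (x y : 'rV[F]_n) :
  inner conj x (alpha t y) = inner conj x y * t.
Proof. by rewrite /inner mulr_suml; apply: eq_bigr => m _; rewrite mxE mulrA. Qed.

Lemma innerR_realC (R : realType) (n : nat) (x y : 'rV[R[i]]_n) :
  innerR (realC x) (realC y) = complex.Re (innerC x y).
Proof.
rewrite /innerR /realC inner_interleave /innerC /inner raddf_sum /=.
apply: eq_bigr => m _.
by case: (x 0 m) (y 0 m) => [a b] [c d] /=; ring.
Qed.

(** Write q = z + k u with z = a + b i and u = d + c i, the two entries of [complexH]. Since conj(k)
    k = 1, conj(q) q' is conj(z) z' + conj(u) u' plus terms in k C = C j. *)
Lemma innerC_complexH (R : realType) (n : nat) (v w : 'rV[quaternion R]_n) :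
  innerC (complexH v) (complexH w) =
  quatr (innerH v w) +i* quati (innerH v w).
Proof.
rewrite /innerC /complexH inner_interleave /innerH /inner.
rewrite (big_morph (fun q : quaternion R => quatr q +i* quati q)
          (id1 := 0) (op1 := +%R)) => [|[a b c d] [a' b' c' d'] //|//].
apply: eq_bigr => m _.
case: (v 0 m) (w 0 m) => [a b c d] [a' b' c' d'].
by apply/eqP; rewrite eq_complex /=; apply/andP; split; apply/eqP; ring.
Qed.

Lemma innerR_realH (R : realType) (n : nat) (v w : 'rV[quaternion R]_n) :
  innerR (realH v) (realH w) = quatr (innerH v w).
Proof. by rewrite /realH /= innerR_realC innerC_complexH. Qed.

Theorem theorem2p2 (R : realType) (n : nat) (n_gt0 : (0 < n)%N)
    (x y : 'rV[R[i]]_n) (v w : 'rV[quaternion R]_n) :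
  [/\ innerC x y =
        (innerR (realC x) (realC y))%:C
        - (innerR (realC x) ((@realC R n \o alpha 'i%C) y))%:C * 'i%C,
      innerH v w =
        (innerC (complexH v) (complexH w))%:H
        - (innerC (complexH v) ((@complexH R n \o alpha qj) w))%:H * qj
    & innerH v w =
        (innerR (realH v) (realH w))%:C%:H
        - (innerR (realH v) ((@realH R n \o alpha qi) w))%:C%:H * qi
        - (innerR (realH v) ((@realH R n \o alpha qj) w))%:C%:H * qj
        - (innerR (realH v) ((@realH R n \o alpha qk) w))%:C%:H * qk].
Proof.
have innerC_alpha t : innerC x (alpha t y) = innerC x y * t.
  exact: inner_alphar.
have innerH_alpha t : innerH v (alpha t w) = innerH v w * t.
  exact: inner_alphar.
split=> /=.
- rewrite !innerR_realC innerC_alpha; case: (innerC x y) => a b.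
  by apply/eqP; rewrite eq_complex /=; apply/andP; split; apply/eqP; ring.
(* For p = a + b i + c j + d k, the component of p j in C is - c - d i, and (c + d i) j = c j + d
   k. *)
- rewrite !innerC_complexH innerH_alpha; case: (innerH v w) => a b c d.
  by congr Quat => /=; ring.
(* The real parts of p i, p j and p k are - b, - c and - d. *)
- rewrite !innerR_realH !innerH_alpha; case: (innerH v w) => a b c d.
  by congr Quat => /=; ring.
Qed.
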